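(* Let $k,n \geq 1$ be integers, let $\ell = a_0 x_0 + \cdots + a_n x_n \in \mathbb{C}[x_0,\dots,x_n]$ be a linear form with $a_0 \cdots a_n \neq 0$, and for $\lambda \in \mathbb{C}\setminus\{0\}$ let $f_\lambda = (x_0 \cdots x_n)^k + \lambda \ell^{(n+1)k}$. Then there exists a unique $\lambda_0 \in \mathbb{C}\setminus\{0\}$ such that $\mathrm{R}(f_{\lambda_0}) = (k+1)^n - 1$, and in this case (i.e. $\lambda = \lambda_0$) the minimal Waring decomposition of $f_{\lambda_0}$ is unique. If $\lambda \neq \lambda_0$, then $\mathrm{R}(f_\lambda) = (k+1)^n$.
   Context: For a homogeneous polynomial $f \in \mathbb{C}[x_0,\dots,x_n]$ of degree $d$, the Waring rank $\mathrm{R}(f)$ is the smallest $r$ such that $f = \ell_1^d + \cdots + \ell_r^d$ for some linear forms $\ell_1,\dots,\ell_r$. A Waring decomposition of $f$ is a finite set of points $\mathbb{X} = \{[\ell_1],\dots,[\ell_r]\}$ in the projective space of linear forms such that $f$ is a linear combination of $\ell_1^d,\dots,\ell_r^d$. It is minimal if $\#\mathbb{X} = \mathrm{R}(f)$. *)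

(* Defs.v *)
From mathcomp Require Import all_boot all_order all_algebra.
From mathcomp Require Import finmap complex mpoly reals.

Set Implicit Arguments.
Unset Strict Implicit.
Unset Printing Implicit Defensive.

Import GRing.Theory.

Local Open Scope ring_scope.

(* A linear form is given by its row of coefficients. *)
Definition linear_form (K : fieldType) (m : nat) (a : 'rV[K]_m) : {mpoly K[m]} :=
  \sum_(i < m) a ord0 i *: 'X_i.

Definition is_sum_of_powers (K : fieldType) (m d : nat) (f : {mpoly K[m]})
    (r : nat) : Prop :=
  exists l : 'I_r -> 'rV[K]_m, f = \sum_(i < r) linear_form (l i) ^+ d.

(* waring_rank d f r reads R(f) = r, for f homogeneous of degree d. *)
Definition waring_rank (K : fieldType) (m d : nat) (f : {mpoly K[m]})
    (r : nat) : Prop :=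
  is_sum_of_powers d f r /\ forall s, is_sum_of_powers d f s -> (r <= s)%N.

(* A point of the projective space of linear forms in m variables is a line
   through the origin in the space of coefficient rows. *)
Definition proj_point (K : fieldType) (m : nat) : choiceType :=
  {p : {vspace 'rV[K]_m} | \dim p == 1%N}.

(* The points of X are [l p], for p in X; the condition on the existence of the
   coefficients c does not depend on the choice of the representatives l. *)
Definition waring_decomposition (K : fieldType) (m d : nat) (f : {mpoly K[m]})
    (X : {fset proj_point K m}) : Prop :=
  exists (l : proj_point K m -> 'rV[K]_m) (c : proj_point K m -> K),
    (forall p, p \in X -> val p = <[l p]>%VS) /\
    f = \sum_(p <- X) c p *: linear_form (l p) ^+ d.

Definition minimal_waring_decomposition (K : fieldType) (m d : nat)
    (f : {mpoly K[m]}) (X : {fset proj_point K m}) : Prop :=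
  waring_decomposition d f X /\ waring_rank d f #|` X|%fset.

Definition f_lambda (K : fieldType) (n k : nat) (a : 'rV[K]_n.+1) (lambda : K) :
    {mpoly K[n.+1]} :=
  (\prod_(i < n.+1) 'X_i) ^+ k + lambda *: linear_form a ^+ (n.+1 * k).

(* Main.v *)
Require Import Defs.
From mathcomp Require Import all_boot all_order all_algebra.
From mathcomp Require Import all_solvable all_field.
From mathcomp Require Import finmap complex mpoly reals zify.

(* If (x_0 ... x_n)^k is a combination of d-th powers of r linear forms, then
   every form of degree d vanishing at the r points has no coefficient on
   (x_0 ... x_n)^k. Applied to suitable multiples of a polynomial of degree at
   most k in each of n affine variables, this shows that no such nonzero
   polynomial vanishes on the points, so r >= (k+1)^n; and in case of equality all
   points satisfy x_i^(k+1) = c_i x_0^(k+1), which determines the decomposition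
   from any one of its points l, together with the coefficient of l^d. It is the
   orbit of l under (k+1)-th roots of unity acting on the coordinates.
   If f_lambda has a decomposition of length less than (k+1)^n, adding
   - lambda l^d turns it into a minimal decomposition of (x_0 ... x_n)^k through l,
   hence everything is determined; lambda_0 is minus the coefficient of l^d. *)

Set Implicit Arguments.
Unset Strict Implicit.
Unset Printing Implicit Defensive.

Import GRing.Theory Num.Theory.

Local Open Scope ring_scope.

(** * Points of a decomposition of the monomial *)

(** The matrix of values has more rows (the functions [F b]) than columns (the points of [s]), so
    its left kernel is nonzero. *)
Lemma exists_relation (K : fieldType) (A : finType) (T : eqType) (s : seq T)
    (F : A -> T -> K) : (size s < #|A|)%N ->
  exists2 g : A -> K, (exists b, g b != 0) &
    forall y, y \in s -> \sum_b g b * F b y = 0.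
Proof.
move=> lt_s_A.
pose M : 'M[K]_(#|A|, size s) :=
  \matrix_(i, j) F (enum_val i) (tnth (in_tuple s) j).
have /rowV0Pn[v /sub_kermxP vM /rV0Pn[i vi]] : kermx M != 0.
  rewrite -mxrank_eq0 mxrank_ker -lt0n subn_gt0.
  exact: leq_ltn_trans (rank_leq_col _) lt_s_A.
exists (fun b => v ord0 (enum_rank b)).
  by exists (enum_val i); rewrite enum_valK.
move=> y /seq_tnthP[j ->]; have /rowP/(_ j) := vM; rewrite !mxE => vMj.
rewrite -[RHS]vMj.
rewrite [RHS](reindex_onto enum_rank enum_val) => [|r _]; last exact: enum_valK.
rewrite [RHS](eq_bigl xpredT) => [|b]; last by rewrite enum_rankK eqxx.
by apply: eq_bigr => b _; rewrite !mxE enum_rankK.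
Qed.

(* The equality [(x_0 ... x_n)^k = \sum_j c_j l_j^((n+1)k)], read off on
   coefficients: [z j] is the coefficient of x_0 in [l_j], [x j i] that of
   x_(i+1), and [kappa] is the inverse of a multinomial coefficient. *)
Definition apolar (K : fieldType) (n k : nat) (I : finType) (c z : I -> K)
    (x : I -> 'I_n -> K) (kappa : K) : Prop :=
  forall (e0 : nat) (e : 'I_n -> nat), (e0 + \sum_i e i = n.+1 * k)%N ->
    \sum_j c j * (z j ^+ e0 * \prod_i x j i ^+ e i)
    = kappa * [forall i, e i == k]%:R.

Section Apolar.

Variables (K : fieldType) (n k : nat) (I : finType) (c z : I -> K).
Variables (x : I -> 'I_n -> K) (kappa : K).
Hypotheses (n_gt0 : (0 < n)%N) (k_gt0 : (0 < k)%N) (kappa_neq0 : kappa != 0).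
Hypothesis apo : apolar k c z x kappa.

Local Notation box := {ffun 'I_n -> 'I_k.+1}.

(** Dehomogenization at x_0 = 1; since division by zero gives 0, it is meaningful only where
    [z j != 0]. *)
Definition affine_point (j : I) : {ffun 'I_n -> K} := [ffun i => x j i / z j].

(* Homogenize the relation, multiply it by [x_0^k \prod_i x_i^(k - b_i)] for [b] of
   maximal degree in its support, and read off the coefficient of
   [(x_0 ... x_n)^k]: only the term [b] contributes. *)
Lemma relation_eq0 (u : K) (i : 'I_n) (g : box -> K) :
    (forall j, c j != 0 -> u != 0 -> z j != 0) ->
    (forall j, c j != 0 -> z j != 0 ->
      u * affine_point j i ^+ k.+1
      + \sum_b g b * \prod_i' affine_point j i' ^+ b i' = 0) ->
  forall b, (u == 0) || (b != [ffun=> ord0]) -> g b = 0.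
Proof.
move=> uz rel b0 ub0; apply/eqP; apply: contraT => gb0.
pose w (b : box) := (\sum_i' b i')%N.
have [b /andP[gb ub] bmax] := @arg_maxnP _ b0
  (fun b => (g b != 0) && ((u == 0) || (b != [ffun=> ord0]))) w
  (introT andP (conj gb0 ub0)).
have {}bmax b' : g b' != 0 -> (w b' <= w b)%N.
  move=> gb'; have [->|b'0] := eqVneq b' [ffun=> ord0].
    by rewrite /w big1 // => i' _; rewrite ffunE.
  by apply: bmax; rewrite gb' b'0 orbT.
set t := w b in bmax.
(* Value at the [j]-th point of the homogenized and multiplied monomial [e]. By [w_eq] its degree is
   (n+1)k as long as the truncated subtraction is exact, whence the bounds on the sum of [e]
   below. *)
pose tm (e : 'I_n -> nat) j :=
  z j ^+ (k + t - \sum_i' e i') * \prod_i' x j i' ^+ (k - b i' + e i').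
have bk i' : (b i' <= k)%N by rewrite -ltnS.
have w_eq : (\sum_i' (k - b i') + t = n * k)%N.
  rewrite -big_split /= (eq_bigr (fun=> k)) => [|i' _]; last by rewrite subnK.
  by rewrite sum_nat_const card_ord.
have sum_tm e : (\sum_i' e i' <= k + t)%N ->
    \sum_j c j * tm e j = kappa * [forall i', e i' == b i']%:R.
  move=> le_e; rewrite [LHS]apo.
    congr (_ * (nat_of_bool _)%:R); apply: eq_forallb => i'.
    by rewrite -[RHS](eqn_add2l (k - b i')) subnK.
  by rewrite big_split /= addnCA subnK // mulSn -w_eq addnCA.
have tmE e j : (\sum_i' e i' <= k + t)%N -> z j != 0 ->
    tm e j = z j ^+ (k + t) * \prod_i' x j i' ^+ (k - b i')
             * \prod_i' affine_point j i' ^+ e i'.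
  move=> le_e zj; rewrite /tm.
  under [X in _ * X = _]eq_bigr do rewrite exprD.
  under [X in _ = _ * X]eq_bigr do rewrite ffunE expr_div_n.
  rewrite prodf_div prodrXr big_split /= -(subnK le_e) exprD addnK -!mulrA.
  congr (_ * _); rewrite [RHS]mulrCA; congr (_ * _).
  by rewrite mulrCA divff ?mulr1 // expf_neq0.
pose e1 i' : nat := if i' == i then k.+1 else 0%N.
have e1S : (\sum_i' e1 i' = k.+1)%N.
  by rewrite (bigD1 i) //= /e1 eqxx big1 ?addn0 // => i' /negPf->.
(* If [u != 0], then [b] is not the constant monomial, so t > 0 and x_0^(k+t) leaves room for
   x_i^(k+1). *)
have le_e1 : u != 0 -> (\sum_i' e1 i' <= k + t)%N.
  move=> u0; rewrite e1S -addn1 leq_add2l lt0n; apply: contraNneq u0 => t0.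
  move: ub; case: eqP => //= _ /eqP[]; apply/ffunP => i'; apply/val_inj.
  move/eqP: t0; rewrite ffunE /= sum_nat_eq0 => /forallP/(_ i')/eqP.
  by [].
have : \sum_j c j * (u * tm e1 j + \sum_b' g b' * tm (fun i' => b' i') j) = 0.
  apply: big1 => j _; have [->|cj] := eqVneq (c j) 0; first by rewrite mul0r.
  have [zj|zj] := eqVneq (z j) 0.
    have /eqP-> : u == 0 by apply: contraTT isT => /(uz j cj); rewrite zj eqxx.
    rewrite mul0r add0r big1 ?mulr0 // => b' _.
    have [->|/bmax le_b'] := eqVneq (g b') 0; first by rewrite mul0r.
    rewrite /tm zj expr0n subn_eq0 leqNgt (leq_ltn_trans le_b') ?mul0r ?mulr0 //.
    by rewrite -[X in (X < _)%N]add0n ltn_add2r.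
  have rj := rel j cj zj.
  transitivity (c j * (z j ^+ (k + t) * \prod_i' x j i' ^+ (k - b i') * 0));
    last by rewrite !mulr0.
  rewrite -{2}rj [in RHS]mulrDr; congr (_ * (_ + _)).
    have [->|u0] := eqVneq u 0; first by rewrite !mul0r mulr0.
    rewrite tmE ?le_e1 // mulrCA; congr (_ * (_ * _)).
    rewrite (bigD1 i) //= /e1 eqxx big1 ?mulr1 // => i' /negPf->.
    by rewrite expr0.
  rewrite mulr_sumr; apply: eq_bigr => b' _.
  have [->|/bmax le_b'] := eqVneq (g b') 0; first by rewrite !mul0r mulr0.
  by rewrite tmE // 1?mulrCA // (leq_trans le_b') // leq_addl.
under eq_bigr do rewrite mulrDr mulrCA mulr_sumr.
rewrite big_split /= -mulr_sumr exchange_big /=.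
(* In this term x_i has exponent k - b_i + k + 1 > k. *)
have -> : u * \sum_j c j * tm e1 j = 0.
  have [->|u0] := eqVneq u 0; first by rewrite mul0r.
  rewrite sum_tm ?le_e1 //.
  case: forallP => [/(_ i)|_]; last by rewrite !mulr0.
  by rewrite /e1 eqxx => /eqP e; move: (bk i); rewrite -e ltnn.
rewrite add0r (bigD1 b) //= [X in _ + X]big1 ?addr0 => [|b' b'b].
  under eq_bigr do rewrite mulrCA.
  rewrite -mulr_sumr sum_tm ?leq_addl //.
  have -> : [forall i', b i' == b i' :> nat] by apply/forallP.
  by move/eqP; rewrite mulr1 mulf_eq0 (negPf gb) (negPf kappa_neq0).
under eq_bigr do rewrite mulrCA.
rewrite -mulr_sumr; have [->|/bmax le_b'] := eqVneq (g b') 0; first by rewrite mul0r.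
rewrite sum_tm ?(leq_trans le_b') ?leq_addl //.
case: forallP => [eb|_]; last by rewrite !mulr0.
by case/eqP: b'b; apply/ffunP => i'; apply/val_inj/eqP; apply: eb.
Qed.

(** * Lower bound for the number of points, and the case of equality *)

Definition active : pred I := fun j => (c j != 0) && (z j != 0).

(** With fewer distinct points, some nonzero polynomial of degree at most [k] in each variable would
    vanish on all of them, against [relation_eq0] with u = 0. *)
Lemma card_active_points :
  (#|box| <= size (undup [seq affine_point j | j in active]))%N.
Proof.
rewrite leqNgt; apply/negP => /(exists_relation
  (fun (b : box) (y : {ffun 'I_n -> K}) => \prod_i y i ^+ b i))[g [b gb] rel].
case/eqP: gb; apply: (@relation_eq0 0 (Ordinal n_gt0)).
- by move=> j _; rewrite eqxx.
- move=> j cj zj; rewrite mul0r add0r; apply: rel.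
  by rewrite mem_undup; apply: image_f; rewrite unfold_in cj zj.
- by rewrite eqxx.
Qed.

Hypothesis card_I : (#|I| <= #|box|)%N.

(** The number of distinct active points, [#|active|] and [#|I|] are squeezed between [#|box|] and
    itself. *)
Lemma all_active : #|I| = #|box| /\ forall j, (c j != 0) && (z j != 0).
Proof.
have le1 : (size (undup [seq affine_point j | j in active]) <= #|active|)%N.
  by rewrite (leq_trans (size_undup _)) // size_image.
have cI : #|active| = #|I|.
  by apply/eqP; rewrite eqn_leq max_card (leq_trans card_I) // (leq_trans card_active_points).
split.
  by apply/eqP; rewrite eqn_leq card_I -cI (leq_trans card_active_points).
move=> j; have /subset_cardP/(_ (subset_predT _))/(_ j) := cI.
by rewrite unfold_in inE.
Qed.

Lemma affine_point_inj : injective affine_point.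
Proof.
have [_ act] := all_active.
have /dinjectiveP inj : uniq [seq affine_point j | j in active].
  rewrite -[uniq _]negbK -ltn_size_undup -leqNgt size_image.
  by rewrite (leq_trans (max_card _)) // (leq_trans card_I) // card_active_points.
by move=> j j' /inj; apply; apply: act.
Qed.

(** Adding x_i^(k+1), indexed by [None], to the [box] monomials gives one more function than points,
    hence a relation. By [relation_eq0] it involves only x_i^(k+1), with nonzero coefficient, and
    the constant 1. *)
Lemma affine_point_exp i j j' :
  affine_point j i ^+ k.+1 = affine_point j' i ^+ k.+1.
Proof.
have [_ act] := all_active.
pose F (b : option box) (y : {ffun 'I_n -> K}) :=
  if b is Some b then \prod_i y i ^+ b i else y i ^+ k.+1.
have [|g [b0 gb0] rel] := @exists_relation K _ _ [seq affine_point j | j in I] F.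
  by rewrite size_image card_option ltnS.
have {}rel y : g None * affine_point y i ^+ k.+1
    + \sum_b g (Some b) * \prod_i' affine_point y i' ^+ b i' = 0.
  rewrite -[RHS](rel (affine_point y)) ?image_f // [RHS](bigD1 None) //=.
  congr (_ + _).
  rewrite (reindex_omap Some id) => [|[b|]] //.
  by apply: eq_big => [b|b _] //; rewrite eqxx.
have g0 : forall b, (g None == 0) || (b != [ffun=> ord0]) -> g (Some b) = 0.
  apply: (@relation_eq0 _ i) => [y _ _|y _ _]; last exact: rel.
  by case/andP: (act y).
have gT : g None != 0.
  apply/negP => /eqP gT; case/eqP: gb0; case: b0 => [b|] //.
  by apply: g0; rewrite gT eqxx.
have const y : g None * affine_point y i ^+ k.+1 = - g (Some [ffun=> ord0]).
  apply/eqP; rewrite -addr_eq0 -[X in _ == X](rel y) (bigD1 [ffun=> ord0]) //=.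
  rewrite [X in _ == _ + (_ + X)]big1 => [|b nzb]; last by rewrite g0 ?mul0r // nzb orbT.
  by rewrite addr0 big1 ?mulr1 // => i' _; rewrite [in X in _ ^+ X]ffunE expr0.
by apply: (mulfI gT); rewrite !const.
Qed.

(* The test form is the homogenization of [\prod_i \sum_s q_i^(k-s) x_i^s], where
   [q] is the [j]-th point: it vanishes at every other point, because there
   [x_i^(k+1) = q_i^(k+1)] for all [i] and [x_i != q_i] for some [i]. *)
Lemma tight_coef j :
  c j * ((k.+1 ^ n)%:R * (z j ^+ k * \prod_i x j i ^+ k)) = kappa.
Proof.
have [_ act] := all_active.
pose w (b : box) := (\sum_i' b i')%N.
have wd b : (w b <= n.+1 * k)%N.
  apply: (@leq_trans (n * k)); last by rewrite mulSn leq_addl.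
  rewrite -[X in (_ <= X * _)%N]card_ord -sum_nat_const leq_sum // => i _.
  by rewrite -ltnS.
pose q := affine_point j.
(* In the expanded test form only the monomial with all b_i = k survives apolarity, and its
   coefficient is 1. *)
have ev : \sum_y c y * (\sum_(b : box) (\prod_i q i ^+ (k - b i))
            * (z y ^+ (n.+1 * k - w b) * \prod_i x y i ^+ b i)) = kappa.
  under eq_bigr do rewrite mulr_sumr; rewrite exchange_big /=.
  rewrite (bigD1 [ffun=> ord_max]) //= [X in _ + X]big1 ?addr0 => [|b b_max].
    under eq_bigr do rewrite mulrCA; rewrite -mulr_sumr apo ?subnK //.
    have -> : [forall i : 'I_n, ([ffun=> ord_max] : box) i == k :> nat].
      by apply/forallP => i; rewrite ffunE.
    by rewrite big1 ?mul1r ?mulr1 // => i _; rewrite [in X in _ ^+ X]ffunE subnn.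
  under eq_bigr do rewrite mulrCA; rewrite -mulr_sumr apo ?subnK //.
  case: forallP => [eb|_]; last by rewrite !mulr0.
  case/eqP: b_max; apply/ffunP => i; apply/val_inj/eqP.
  by rewrite ffunE; apply: eb.
have fac y : \sum_(b : box) (\prod_i q i ^+ (k - b i))
            * (z y ^+ (n.+1 * k - w b) * \prod_i x y i ^+ b i)
    = z y ^+ (n.+1 * k)
      * \prod_i \sum_(s < k.+1) q i ^+ (k - s) * affine_point y i ^+ s.
  rewrite bigA_distr_bigA mulr_sumr; apply: eq_bigr => b _.
  rewrite big_split /= [RHS]mulrCA; congr (_ * _).
  under [in RHS]eq_bigr do rewrite ffunE expr_div_n.
  rewrite prodf_div prodrXr -{2}(subnK (wd b)) exprD -mulrA; congr (_ * _).
  by rewrite mulrCA divff ?mulr1 // expf_neq0 //; case/andP: (act y).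
rewrite -[RHS]ev (bigD1 j) //= [X in _ + X]big1 => [|y y_j].
  rewrite addr0 fac; congr (_ * _).
  have -> : \prod_i \sum_(s < k.+1) q i ^+ (k - s) * affine_point j i ^+ s
      = \prod_i (k.+1%:R * (x j i ^+ k / z j ^+ k)).
    apply: eq_bigr => i _; rewrite (eq_bigr (fun=> q i ^+ k)) => [|s _].
      by rewrite sumr_const card_ord mulr_natl -expr_div_n /q ffunE.
    by rewrite -exprD subnK // -ltnS.
  rewrite big_split /= prodr_const card_ord -natrX [RHS]mulrCA; congr (_ * _).
  rewrite prodf_div prodr_const card_ord -exprM mulSn exprD [(k * n)%N]mulnC -!mulrA.
  congr (_ * _).
  by rewrite mulrCA divff ?mulr1 // expf_neq0 //; case/andP: (act j).
rewrite fac; have [i qi] : exists i, affine_point y i != q i.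
  apply/existsP; apply: contraR y_j => /existsPn h; apply/eqP/affine_point_inj.
  by apply/ffunP => i; apply/eqP; move: (h i); rewrite negbK.
rewrite (bigD1 i) //= (_ : \sum_(s < k.+1) _ = 0) ?mul0r ?mulr0 //.
have := subrXX (q i) (affine_point y i) k.+1.
rewrite (affine_point_exp i j y) subrr => /esym/eqP.
by rewrite mulf_eq0 subr_eq0 eq_sym (negPf qi) => /eqP.
Qed.

End Apolar.

(** * Powers of linear forms *)

(** Counts the words of length [d] with content [b], which is what expanding a [d]-th power by
    distributivity produces; it is 0 unless [b] has degree [d]. *)
Definition multinomial (m d : nat) (b : 'X_{1..m}) : nat :=
  #|[set f : {ffun 'I_d -> 'I_m} | (\sum_(j < d) U_(f j))%MM == b]|.

Lemma mcoeff_linear_form_exp (K : fieldType) (m d : nat) (a : 'rV[K]_m)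
    (b : 'X_{1..m}) :
  (linear_form a ^+ d)@_b
    = (multinomial d b)%:R * \prod_(i < m) a ord0 i ^+ b i.
Proof.
have -> : linear_form a ^+ d = \sum_(f : {ffun 'I_d -> 'I_m})
    (\prod_(j < d) a ord0 (f j)) *: 'X_[(\sum_(j < d) U_(f j))%MM].
  rewrite -[X in _ ^+ X]card_ord -prodr_const /linear_form bigA_distr_bigA.
  by apply: eq_bigr => f _; rewrite scaler_prod mprodXE.
rewrite raddf_sum /= /multinomial -sum1dep_card natr_sum mulr_suml.
rewrite [RHS]big_mkcond /=; apply: eq_bigr => f _.
rewrite mcoeffZ mcoeffX; case: eqP => [<-|_]; last by rewrite mulr0.
rewrite mulr1 mul1r -(mevalX (a ord0)) -mprodXE rmorph_prod /=.
by apply: eq_bigr => j _; rewrite mevalXU.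
Qed.

(** Lets multinomial coefficients be cancelled in characteristic zero. A word is built by splitting
    off one variable occurring in [b]. *)
Lemma multinomial_gt0 (m d : nat) (b : 'X_{1..m}) :
  (0 < multinomial d b)%N = (mdeg b == d).
Proof.
apply/card_gt0P/eqP => [[f]|].
  rewrite inE => /eqP <-; rewrite mdeg_sum (eq_bigr (fun=> 1%N)) => [|j _].
    by rewrite sum1_card card_ord.
  exact: mdeg1.
elim: d b => [|d IHd] b db.
  have /eqP -> : b == 0%MM by rewrite -mdeg_eq0 db.
  have /card_gt0P[f _] : (0 < #|{ffun 'I_0 -> 'I_m}|)%N.
    by rewrite card_ffun !card_ord expn0.
  by exists f; rewrite inE big_ord0.
have /existsP[i bi] : [exists i, b i != 0%N].
  apply: contraT => /existsPn b0; move/eqP: db; rewrite mdegE big1 // => i _.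
  by apply/eqP; move: (b0 i); rewrite negbK.
have le_ib : (U_(i) <= b)%MM.
  by apply/mnm_lepP => j; rewrite mnm1E; case: eqP => //= <-; rewrite lt0n.
have [|f] := IHd (b - U_(i))%MM.
  by apply/eqP; rewrite -(eqn_add2r 1) -(mdeg1 i) -mdegD submK // db mdeg1 addn1.
rewrite inE => /eqP fb.
exists [ffun j => if unlift ord0 j is Some j' then f j' else i].
rewrite inE big_ord_recl ffunE unlift_none.
rewrite (eq_bigr (fun j => U_(f j)%MM)) => [|j _]; last by rewrite ffunE liftK.
by rewrite fb addmC submK.
Qed.

Lemma prodX_exp (K : fieldType) (m k : nat) :
  (\prod_(i < m) 'X_i) ^+ k = 'X_[[multinom k | i < m]] :> {mpoly K[m]}.
Proof.
rewrite mprodXE mpolyXn; congr 'X_[_]; apply/mnmP => i.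
rewrite mulmnE mnm_sumE mnmE (bigD1 i) //= mnm1E eqxx big1 ?addn0 ?mul1n //.
by move=> j /negPf j_i; rewrite mnm1E j_i.
Qed.

(** * Decompositions of the monomial, read on coefficients *)

Section Monomial.

Variables (K : numClosedFieldType) (n k : nat).

Definition kappa : K := (multinomial (n.+1 * k) [multinom k | i < n.+1])%:R^-1.

Lemma mdeg_const : mdeg [multinom k | i < n.+1] = (n.+1 * k)%N.
Proof.
rewrite mdegE (eq_bigr (fun=> k)) => [|i _]; last exact: mnmE.
by rewrite sum_nat_const card_ord.
Qed.

Lemma kappa_neq0 : kappa != 0.
Proof. by rewrite invr_eq0 pnatr_eq0 -lt0n multinomial_gt0 mdeg_const. Qed.

Lemma apolar_of_decomposition (I : finType) (c : I -> K) (l : I -> 'rV[K]_n.+1) :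
    (\prod_(i < n.+1) 'X_i) ^+ k
      = \sum_j c j *: linear_form (l j) ^+ (n.+1 * k) ->
  apolar k c (fun j => l j ord0 ord0) (fun j i => l j ord0 (lift ord0 i)) kappa.
Proof.
move=> dec e0 e de.
pose b := [multinom if unlift ord0 i is Some j then e j else e0 | i < n.+1].
have b0 : b ord0 = e0 by rewrite mnmE unlift_none.
have bS i : b (lift ord0 i) = e i by rewrite mnmE liftK.
have db : mdeg b = (n.+1 * k)%N.
  by rewrite mdegE big_ord_recl b0 -de; congr addn; apply: eq_bigr => i _; apply: bS.
have /(congr1 (mcoeff b)) := dec; rewrite prodX_exp mcoeffX raddf_sum /=.
have <- : ([multinom k | i < n.+1] == b) = [forall i, e i == k].
  apply/eqP/forallP => [bk i|ek]; first by rewrite -bS -bk mnmE.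
  have {}ek i : e i = k by apply/eqP.
  apply/mnmP => i; rewrite mnmE; case: (unliftP ord0 i) => [j|] ->.
    by rewrite bS ek.
  (* The exponent of x_0 is forced by the total degree. *)
  rewrite b0; apply/(@addIn (\sum_i e i)).
  by rewrite de (eq_bigr (fun=> k)) // sum_nat_const card_ord mulSn.
under eq_bigr do rewrite mcoeffZ mcoeff_linear_form_exp mulrCA big_ord_recl b0.
under eq_bigr do under eq_bigr do rewrite bS.
rewrite -mulr_sumr => eqb.
have Mb : (multinomial (n.+1 * k) b)%:R != 0 :> K.
  by rewrite pnatr_eq0 -lt0n multinomial_gt0 db.
apply: (mulfI Mb); rewrite -eqb; case: eqP => [bk|_]; last by rewrite !mulr0.
by rewrite /kappa bk mulr1 mulfV.
Qed.

End Monomial.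

(** * The decomposition through a given point *)

(** X^N - 1 splits and is separable, so it has N distinct roots. *)
Lemma prim_root_exists (K : numClosedFieldType) (N : nat) : (0 < N)%N ->
  exists w : K, N.-primitive_root w.
Proof.
move=> N_gt0; pose p : {poly K} := 'X^N - 1.
have [r Dp] := closed_field_poly_normal p.
rewrite (monicP _) ?monicXnsubC // scale1r in Dp.
have rN1 : all N.-unity_root r by apply/allP=> w; rewrite -root_prod_XsubC -Dp.
have sz_r : (N < (size r).+1)%N.
  by rewrite -(size_prod_XsubC r id) -Dp size_XnsubC.
have [|w] := hasP (has_prim_root N_gt0 rN1 _ sz_r); last by exists w.
by rewrite -separable_prod_XsubC -Dp separable_Xn_sub_1 // pnatr_eq0 -lt0n.
Qed.

(** Orthogonality of characters of the cyclic group generated by [w]; the shift [b.+1] comes from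
    the weight in [orbit_coef]. *)
Lemma sum_prim_root_expX (K : fieldType) (k b : nat) (w : K) :
    k.+1.-primitive_root w ->
  \sum_(s < k.+1) (w ^+ s) ^+ b.+1 = if (k.+1 %| b.+1)%N then k.+1%:R else 0.
Proof.
move=> prim_w; have [dv|ndv] := ifP.
  rewrite (eq_bigr (fun=> 1)) => [|s _]; first by rewrite sumr_const card_ord.
  by rewrite -exprM; apply/eqP; rewrite -(prim_order_dvd prim_w) dvdn_mull.
have w1 : w ^+ b.+1 - 1 != 0 by rewrite subr_eq0 -(prim_order_dvd prim_w) ndv.
apply: (mulfI w1); rewrite mulr0.
under eq_bigr do rewrite exprAC.
by rewrite -subrX1 exprAC (prim_expr_order prim_w) expr1n subrr.
Qed.

(* An exponent equal to [k] modulo [k+1] and different from [k] is at least [2k+1],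
   which makes the degree exceed [(n+1)k]. *)
Lemma exponents_eq (n k : nat) (b : 'X_{1..n.+1}) : mdeg b = (n.+1 * k)%N ->
    (forall j : 'I_n, k.+1 %| (b (lift ord0 j)).+1)%N ->
  b = [multinom k | i < n.+1].
Proof.
rewrite mdegE big_ord_recl mulSn => db dv.
have ge j : (k <= b (lift ord0 j))%N by rewrite -ltnS; apply: dvdn_leq (dv j).
have bS j : b (lift ord0 j) = k.
  have [q bq] := dvdnP (dv j); apply/eqP; rewrite eqn_leq ge andbT leqNgt.
  apply/negP => lt_kb.
  have q2 : (2 <= q)%N.
    by rewrite -(@ltn_pmul2r k.+1) // mul1n -bq ltnS.
  have : (k + n * k < \sum_(j < n) b (lift ord0 j))%N.
    rewrite (bigD1 j) //=.
    have : (\sum_(i < n) k = n * k)%N by rewrite sum_nat_const card_ord.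
    rewrite (bigD1 j) //= => <-.
    rewrite addnA -addSn; apply: leq_add; last exact: leq_sum.
    have := leq_mul q2 (leqnn k.+1); rewrite -bq; lia.
  by rewrite -db leqNgt ltnS leq_addl.
apply/mnmP => i; rewrite mnmE; case: (unliftP ord0 i) => [j|] -> //.
apply/eqP; rewrite -(eqn_add2r (n * k)) -db.
by rewrite (eq_bigr (fun=> k)) // sum_nat_const card_ord.
Qed.

Section Orbit.

Variables (K : numClosedFieldType) (n k : nat) (a : 'rV[K]_n.+1) (w : K).
Hypotheses (n_gt0 : (0 < n)%N) (k_gt0 : (0 < k)%N).
Hypothesis (a_neq0 : forall i, a ord0 i != 0).
Hypothesis (prim_w : k.+1.-primitive_root w).

Local Notation box := {ffun 'I_n -> 'I_k.+1}.
Local Notation d := (n.+1 * k)%N.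

(** The coefficient of x_0 is left fixed, so that distinct [e] give distinct projective points. *)
Definition orbit_row (e : box) : 'rV[K]_n.+1 :=
  \row_i (if unlift ord0 i is Some j then a ord0 i * w ^+ e j else a ord0 i).

(* The coefficient of [linear_form a ^+ d] in the decomposition through [a]. *)
Definition base_coef : K := kappa K n k / ((k.+1 ^ n)%:R * \prod_i a ord0 i ^+ k).

(** The weight is the character that selects exponents congruent to -1, that is to [k], modulo
    k+1. *)
Definition orbit_coef (e : box) : K := base_coef * \prod_i w ^+ e i.

Lemma orbit_row0 e : orbit_row e ord0 ord0 = a ord0 ord0.
Proof. by rewrite mxE unlift_none. Qed.

Lemma orbit_rowS e j :
  orbit_row e ord0 (lift ord0 j) = a ord0 (lift ord0 j) * w ^+ e j.
Proof. by rewrite mxE liftK. Qed.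

Lemma orbit_row_id : orbit_row [ffun=> ord0] = a.
Proof.
apply/rowP => i; case: (unliftP ord0 i) => [j|] ->; last exact: orbit_row0.
by rewrite orbit_rowS ffunE expr0 mulr1.
Qed.

Lemma orbit_coef_id : orbit_coef [ffun=> ord0] = base_coef.
Proof.
by rewrite /orbit_coef big1 ?mulr1 // => i _; rewrite ffunE expr0.
Qed.

Lemma base_coef_neq0 : base_coef != 0.
Proof.
rewrite mulf_neq0 ?kappa_neq0 // invr_eq0 mulf_neq0 //.
  by rewrite pnatr_eq0 -lt0n expn_gt0.
by apply/prodf_neq0 => i _; rewrite expf_neq0.
Qed.

Lemma monomial_decomposition :
  (\prod_(i < n.+1) 'X_i) ^+ k
    = \sum_e orbit_coef e *: linear_form (orbit_row e) ^+ d.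
Proof.
apply/mpolyP => b; rewrite prodX_exp mcoeffX raddf_sum /=.
under eq_bigr do rewrite mcoeffZ mcoeff_linear_form_exp mulrCA.
rewrite -mulr_sumr; have [db|db] := eqVneq (mdeg b) d; last first.
  have /eqP -> : (multinomial d b == 0)%N by rewrite eqn0Ngt multinomial_gt0 (negPf db).
  rewrite mul0r; case: eqP => // bk; case/eqP: db; rewrite -bk; exact: mdeg_const.
(* By distributivity the sum over the orbit is a product of [n] character sums, one for each
   variable other than x_0. *)
have -> : \sum_e orbit_coef e * \prod_i orbit_row e ord0 i ^+ b i
    = base_coef * (\prod_i a ord0 i ^+ b i) *
      \prod_(j < n) \sum_(s < k.+1) (w ^+ s) ^+ (b (lift ord0 j)).+1.
  rewrite bigA_distr_bigA mulr_sumr; apply: eq_bigr => e _.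
  rewrite !big_ord_recl /orbit_coef orbit_row0; move: base_coef => C.
  rewrite -!mulrA; congr (_ * _).
  rewrite mulrCA; congr (_ * _).
  rewrite -!big_split /=; apply: eq_bigr => j _.
  by rewrite orbit_rowS exprMn exprS mulrCA.
under [\prod_(j < n) \sum_(s < k.+1) _]eq_bigr do rewrite (sum_prim_root_expX _ prim_w).
case: eqP => [<-|b_k].
  under eq_bigr do rewrite mnmE.
  under [\prod_(j < n) _]eq_bigr do rewrite mnmE dvdnn.
  rewrite prodr_const card_ord -natrX /base_coef /kappa.
  have p0 : \prod_i a ord0 i ^+ k != 0 by apply/prodf_neq0 => i _; rewrite expf_neq0.
  have N0 : (k.+1 ^ n)%:R != 0 :> K by rewrite pnatr_eq0 -lt0n expn_gt0.
  have := kappa_neq0 K n k; rewrite invr_eq0 => M0.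
  by rewrite -[_ * _ * (_ ^ _)%:R]mulrA [_ * (_ ^ _)%:R]mulrC divfK ?mulfV ?mulf_neq0.
have /existsP[j /negPf ndv] : [exists j : 'I_n, ~~ (k.+1 %| (b (lift ord0 j)).+1)%N].
  apply: contra_notT b_k => /existsPn dv; apply/esym/exponents_eq => // j.
  by move: (dv j); rewrite negbK.
by rewrite (bigD1 j) //= ndv mul0r !mulr0.
Qed.

Lemma orbit_point_inj e e' : <[orbit_row e]>%VS = <[orbit_row e']>%VS -> e = e'.
Proof.
move=> eqv; have /vlineP[u eu] : orbit_row e \in <[orbit_row e']>%VS.
  by rewrite -eqv memv_line.
have u1 : u = 1.
  have /rowP/(_ ord0) := eu; rewrite [RHS]mxE !orbit_row0 => /eqP.
  by rewrite -{1}[a _ _]mul1r => /eqP/(mulIf (a_neq0 _)).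
apply/ffunP => j; have /rowP/(_ (lift ord0 j)) := eu.
rewrite u1 scale1r !orbit_rowS => /(mulfI (a_neq0 _))/eqP.
by rewrite (eq_prim_root_expr prim_w) !modn_small // => /eqP/val_inj.
Qed.

Lemma orbit_row_neq0 e : orbit_row e != 0.
Proof.
apply: contraNneq (a_neq0 ord0) => e0.
by rewrite -(orbit_row0 e) e0 mxE.
Qed.

(** The bound on [#|I|] makes the decomposition of the monomial by the [l j] and [a] tight:
    [tight_coef] at [a] gives [lambda], and [affine_point_exp] places every [l j] in the orbit. *)
Lemma short_decomposition (lambda : K) (I : finType) (c : I -> K)
    (l : I -> 'rV[K]_n.+1) :
    f_lambda k a lambda = \sum_j c j *: linear_form (l j) ^+ d ->
    (#|I| < k.+1 ^ n)%N ->
  [/\ lambda = - base_coef, #|I|.+1 = (k.+1 ^ n)%N &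
    forall j, exists2 e : box, e != [ffun=> ord0] & <[l j]>%VS = <[orbit_row e]>%VS].
Proof.
move=> dec card_I.
have cbox : #|box| = (k.+1 ^ n)%N by rewrite card_ffun !card_ord.
(* [None] indexes the extra point [a], with coefficient - [lambda]. *)
pose c' (j : option I) := if j is Some i then c i else - lambda.
pose l' (j : option I) := if j is Some i then l i else a.
have /apolar_of_decomposition apo : (\prod_(i < n.+1) 'X_i) ^+ k
    = \sum_j c' j *: linear_form (l' j) ^+ d.
  rewrite (bigD1 None) //= (reindex_omap Some id) => [|[j|]] //=.
  under [X in _ + X]eq_bigl do rewrite eqxx.
  by rewrite -dec /f_lambda scaleNr addrC addrK.
pose z j := l' j ord0 ord0; pose x j i := l' j ord0 (lift ord0 i).
have {}apo : apolar k c' z x (kappa K n k) := apo.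
have card_oI : (#|{: option I}| <= #|box|)%N by rewrite card_option cbox.
have kn0 := kappa_neq0 K n k.
have [eqN act] := all_active n_gt0 k_gt0 kn0 apo card_oI.
have inj := affine_point_inj n_gt0 k_gt0 kn0 apo card_oI.
have expE := affine_point_exp n_gt0 k_gt0 kn0 apo card_oI.
split.
- have D0 : (k.+1 ^ n)%:R * \prod_i a ord0 i ^+ k != 0.
    rewrite mulf_neq0 ?pnatr_eq0 -?lt0n ?expn_gt0 //.
    by apply/prodf_neq0 => i _; rewrite expf_neq0.
  apply: (mulIf D0); rewrite mulNr divfK // big_ord_recl.
  by rewrite -(tight_coef n_gt0 k_gt0 kn0 apo card_oI None) mulNr opprK.
- by rewrite -cbox -eqN card_option.
move=> j.
(* The quotient of the affine coordinates of [l j] and [a] is a (k+1)-th root of unity. *)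
have root_j i : exists s : 'I_k.+1,
    affine_point z x (Some j) i = affine_point z x None i * w ^+ s.
  have q0 : affine_point z x None i != 0.
    by rewrite ffunE mulf_neq0 ?invr_eq0 //; apply: a_neq0.
  have [|s qs] := prim_rootP prim_w
    (x := affine_point z x (Some j) i / affine_point z x None i).
    by rewrite expr_div_n (expE i (Some j) None) divff // expf_neq0.
  by exists s; rewrite -qs mulrCA divff ?mulr1.
have [e eE] := fin_all_exists root_j.
have z0 : l j ord0 ord0 != 0 by case/andP: (act (Some j)).
have lE : l j = (l j ord0 ord0 / a ord0 ord0) *: orbit_row (finfun e).
  apply/rowP => i; rewrite mxE; case: (unliftP ord0 i) => [i'|] ->.
    have := eE i'; rewrite !ffunE /= orbit_rowS ffunE => eqi.
    rewrite -[LHS](divfK z0) eqi [LHS]mulrC -!mulrA; congr (_ * _).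
    exact: mulrCA.
  by rewrite orbit_row0 divfK.
exists (finfun e).
  (* Trivial exponents would make [l j] and [a] the same affine point, against injectivity. *)
  apply/eqP => e0; suff : Some j = None by [].
  apply: inj; apply/ffunP => i; rewrite eE.
  by have /ffunP/(_ i) := e0; rewrite !ffunE => ->; rewrite expr0 mulr1.
apply/eqP; rewrite eqEsubv -!memvE {1}lE memvZ ?memv_line //=.
have u0 : l j ord0 ord0 / a ord0 ord0 != 0 by rewrite mulf_neq0 ?invr_eq0.
by rewrite -[orbit_row _](scalerK u0) -lE memvZ ?memv_line.
Qed.

End Orbit.

(** * Ranks and decompositions of [f_lambda] *)

Lemma linear_formZ (K : fieldType) (m : nat) (u : K) (v : 'rV[K]_m) :
  linear_form (u *: v) = u *: linear_form v.
Proof.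
by rewrite /linear_form scaler_sumr; apply: eq_bigr => i _; rewrite mxE scalerA.
Qed.

(** Each coefficient is absorbed into its linear form through a [d]-th root. *)
Lemma is_sum_of_powers_scaled (K : numClosedFieldType) (m d : nat)
    (f : {mpoly K[m]}) (I : finType) (P : pred I) (c : I -> K) (l : I -> 'rV[K]_m) :
    (0 < d)%N -> f = \sum_(j | P j) c j *: linear_form (l j) ^+ d ->
  is_sum_of_powers d f #|P|.
Proof.
move=> d_gt0 ->.
exists (fun r => d.-root (c (enum_val r)) *: l (enum_val r)).
rewrite [LHS](big_enum_val (A := P)).
by apply: eq_bigr => r _; rewrite linear_formZ exprZn rootCK.
Qed.

Lemma waring_rank_inj (K : fieldType) (m d : nat) (f : {mpoly K[m]}) (r s : nat) :
  waring_rank d f r -> waring_rank d f s -> r = s.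
Proof.
by move=> [fr ler] [fs les]; apply/eqP; rewrite eqn_leq ler ?les.
Qed.

Section Assembly.

Variables (K : numClosedFieldType) (n k : nat) (a : 'rV[K]_n.+1) (w : K).
Hypotheses (n_gt0 : (0 < n)%N) (k_gt0 : (0 < k)%N).
Hypothesis (a_neq0 : forall i, a ord0 i != 0).
Hypothesis (prim_w : k.+1.-primitive_root w).

Local Notation box := {ffun 'I_n -> 'I_k.+1}.
Local Notation d := (n.+1 * k)%N.
Local Notation lambda0 := (- base_coef k a).
Local Notation id_box := ([ffun=> ord0] : box).

(** The term at [a] of [monomial_decomposition] merges with [lambda] times the power, and cancels it
    exactly at [lambda0]. *)
Lemma f_lambda_decomposition (lambda : K) :
  f_lambda k a lambda
    = (lambda - lambda0) *: linear_form a ^+ d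
      + \sum_(e | e != id_box) orbit_coef a w e *: linear_form (orbit_row a w e) ^+ d.
Proof.
rewrite /f_lambda (monomial_decomposition a_neq0 prim_w) (bigD1 id_box) //=.
rewrite orbit_coef_id orbit_row_id opprK scalerDl.
by rewrite addrAC [X in X + _ = _]addrC.
Qed.

Lemma d_gt0 : (0 < d)%N.
Proof. by rewrite muln_gt0. Qed.

Lemma card_box : #|box| = (k.+1 ^ n)%N.
Proof. by rewrite card_ffun !card_ord. Qed.

Lemma sum_of_powers_short (lambda : K) (s : nat) :
    is_sum_of_powers d (f_lambda k a lambda) s -> (s < k.+1 ^ n)%N ->
  lambda = lambda0 /\ s.+1 = (k.+1 ^ n)%N.
Proof.
move=> [l dec] lt_s; have [] := @short_decomposition _ _ _ _ _ n_gt0 k_gt0 a_neq0 prim_w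
  lambda 'I_s (fun=> 1) l.
- by rewrite dec; apply: eq_bigr => j _; rewrite scale1r.
- by rewrite card_ord.
by rewrite card_ord => -> ->.
Qed.

Lemma waring_rank_lambda0 :
  waring_rank d (f_lambda k a lambda0) (k.+1 ^ n).-1.
Proof.
split.
  have -> : (k.+1 ^ n).-1 = #|[pred e : box | e != id_box]|.
    by rewrite cardC1 card_box.
  apply: (is_sum_of_powers_scaled (c := orbit_coef a w) (l := orbit_row a w) d_gt0).
  by rewrite f_lambda_decomposition subrr scale0r add0r.
move=> s ds; rewrite leqNgt; apply/negP => lt_s.
have [|_ sE] := sum_of_powers_short ds.
  by rewrite (leq_trans lt_s) // leq_pred.
by move: lt_s; rewrite -sE ltnn.
Qed.

Lemma waring_rank_generic (lambda : K) : lambda != lambda0 ->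
  waring_rank d (f_lambda k a lambda) (k.+1 ^ n).
Proof.
move=> l0; split.
  rewrite -card_box.
  apply: (@is_sum_of_powers_scaled _ _ _ _ box predT
    (fun e => if e == id_box then lambda - lambda0 else orbit_coef a w e)
    (orbit_row a w) d_gt0).
  rewrite f_lambda_decomposition [RHS](bigD1 id_box) //= eqxx orbit_row_id.
  by congr (_ + _); apply: eq_bigr => e /negPf->.
move=> s ds; rewrite leqNgt; apply/negP => lt_s.
by have [/eqP] := sum_of_powers_short ds lt_s; rewrite (negPf l0).
Qed.

(** * Uniqueness of the minimal decomposition for [lambda0] *)

Lemma dim_orbit_row (e : box) : \dim <[orbit_row a w e]>%VS == 1%N.
Proof. by rewrite dim_vline orbit_row_neq0. Qed.

Definition orbit_point (e : box) : proj_point K n.+1 :=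
  exist _ <[orbit_row a w e]>%VS (dim_orbit_row e).

Lemma orbit_point_injective : injective orbit_point.
Proof. by move=> e e' /(congr1 val)/(orbit_point_inj a_neq0 prim_w). Qed.

Definition punctured_orbit : {fset proj_point K n.+1} :=
  seq_fset tt [seq orbit_point e | e in predC1 id_box].

Lemma punctured_orbit_uniq : uniq [seq orbit_point e | e in predC1 id_box].
Proof. by rewrite map_inj_uniq ?enum_uniq //; apply: orbit_point_injective. Qed.

Lemma card_punctured_orbit : #|` punctured_orbit|%fset = (k.+1 ^ n).-1.
Proof.
by rewrite size_seq_fset undup_id ?punctured_orbit_uniq // size_image cardC1 card_box.
Qed.

Lemma minimal_punctured_orbit :
  minimal_waring_decomposition d (f_lambda k a lambda0) punctured_orbit.
Proof.
split; last by rewrite card_punctured_orbit; apply: waring_rank_lambda0.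
(* Representatives and coefficients must be functions of the projective point, so [orbit_point] is
   inverted, with default 0 off the orbit. *)
pose idx p : option box := [pick e | orbit_point e == p].
have idxE e : idx (orbit_point e) = Some e.
  rewrite /idx; case: pickP => [e' /eqP/orbit_point_injective->|/(_ e)] //.
  by rewrite eqxx.
exists (fun p => oapp (orbit_row a w) 0 (idx p)),
  (fun p => oapp (orbit_coef a w) 0 (idx p)).
split.
  by move=> p; rewrite seq_fsetE => /imageP[e _ ->]; rewrite idxE.
rewrite (perm_big _ (seq_fset_perm _ _)) undup_id ?punctured_orbit_uniq //=.
rewrite big_image /= f_lambda_decomposition subrr scale0r add0r.
by apply: eq_bigr => e _; rewrite idxE.
Qed.

(** By [short_decomposition] every point of [X] lies in the punctured orbit, and the cardinalities
    agree. *)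
Lemma minimal_decomposition_unique (X : {fset proj_point K n.+1}) :
  minimal_waring_decomposition d (f_lambda k a lambda0) X -> X = punctured_orbit.
Proof.
move=> [[l [c [lX dec]]] rkX].
have cX : #|` X|%fset = (k.+1 ^ n).-1 := waring_rank_inj rkX waring_rank_lambda0.
apply/eqP; rewrite eqEfcard cX card_punctured_orbit leqnn andbT.
have [] := @short_decomposition _ _ _ _ _ n_gt0 k_gt0 a_neq0 prim_w
  lambda0 X (fun p => c (val p)) (fun p => l (val p)).
- by rewrite dec big_seq_fsetE.
- by rewrite -cardfE cX ltn_predL expn_gt0.
move=> _ _ XP; apply/fsubsetP => p pX.
have [e e0 le] := XP [` pX]%fset.
rewrite seq_fsetE; apply/imageP; exists e => //.
by apply/val_inj; rewrite (lX p pX).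
Qed.

End Assembly.

Theorem proposition3p1 (R : realType) (k n : nat) (hk : (1 <= k)%N) (hn : (1 <= n)%N)
    (a : 'rV[R[i]]_n.+1) (ha : \prod_(i < n.+1) a ord0 i != 0) :
  let d := (n.+1 * k)%N in
  exists lambda0 : R[i],
    [/\ unique (fun lambda : R[i] => lambda != 0 /\
          waring_rank d (f_lambda k a lambda) ((k + 1) ^ n - 1)) lambda0,
        exists! X : {fset proj_point R[i] n.+1},
          minimal_waring_decomposition d (f_lambda k a lambda0) X
      & forall lambda : R[i], lambda != 0 -> lambda != lambda0 ->
          waring_rank d (f_lambda k a lambda) ((k + 1) ^ n)].
Proof.
move=> d; rewrite addn1 subn1.
have a_neq0 i : a ord0 i != 0 by move/prodf_neq0: ha; apply.
have [w prim_w] := prim_root_exists R[i] (ltn0Sn k).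
exists (- base_coef k a); split.
- split.
    rewrite oppr_eq0 base_coef_neq0 //; split=> //.
    exact: (waring_rank_lambda0 hn hk a_neq0 prim_w).
  move=> lambda [_ [dec _]].
  have [|-> //] := sum_of_powers_short hn hk a_neq0 prim_w dec.
  by rewrite ltn_predL expn_gt0.
- exists (punctured_orbit k w a_neq0); split; first exact: minimal_punctured_orbit.
  by move=> X /(minimal_decomposition_unique hn hk a_neq0 prim_w) ->.
by move=> lambda _; apply: (waring_rank_generic hn hk a_neq0 prim_w).
Qed.
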